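(* Let $n\geq 4$ and $2\leq i<n$ be integers, and let $a,b$ be rational numbers with $b\neq 0$. Then the system of Diophantine equations \[ \sigma_{i}(x_{1},\ldots,x_{n})=a,\qquad \sigma_{n}(x_{1},\ldots,x_{n})=b \] has infinitely many rational parametric solutions depending on $n-3$ free parameters; that is, there are infinitely many distinct $n$-tuples $(x_1,\ldots,x_n)$ of rational functions in $n-3$ independent indeterminates over $\mathbb{Q}$ which satisfy the system identically.
   Context: For $1\leq i\leq n$, $\sigma_{i}(x_{1},\ldots,x_{n})=\sum_{1\leq k_{1}<k_{2}<\cdots<k_{i}\leq n}x_{k_{1}}\cdots x_{k_{i}}$ denotes the $i$-th elementary symmetric polynomial; $\sigma_n$ is the product of the variables. *)

(* Defs.v *)
From mathcomp Require Import all_boot all_order all_algebra.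
From mathcomp Require Export mpoly.

Set Implicit Arguments.
Unset Strict Implicit.
Unset Printing Implicit Defensive.

Import GRing.Theory.
Local Open Scope ring_scope.

(* The field Q(t_0, ..., t_(m-1)) of rational functions in m indeterminates. *)
Definition ratfun (m : nat) : fieldType := {fraction {mpoly rat[m]}}.

Definition ratfun_const (m : nat) (c : rat) : ratfun m :=
  tofrac (c%:MP : {mpoly rat[m]}).

Definition sigma (F : fieldType) (n k : nat) (x : {ffun 'I_n -> F}) : F :=
  (mesym n F k).@[x].

Definition parametric_solution (n i m : nat) (a b : rat)
    (x : {ffun 'I_n -> ratfun m}) : Prop :=
  sigma i x = ratfun_const m a /\ sigma n x = ratfun_const m b.

Definition alg_independent (m r : nat) (y : 'I_r -> ratfun m) : Prop :=
  forall p : {mpoly rat[r]}, mmap (@ratfun_const m) y p = 0 -> p = 0.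

(* Q(x_0, ..., x_(n-1)) has transcendence degree m over Q, so that all m
   parameters are free: m of the coordinates of x are algebraically independent
   over Q (algebraic independence forces f to be injective).  This excludes, for
   instance, constant tuples when m > 0. *)
Definition depends_on_all_parameters (n m : nat)
    (x : {ffun 'I_n -> ratfun m}) : Prop :=
  exists f : 'I_m -> 'I_n, alg_independent (x \o f).

(* Main.v *)
(* Fix all but three coordinates and let T, e_j be their product and their
   elementary symmetric functions. The remaining three coordinates lie on the
   cubic e_(i-1) s_1 + e_(i-2) s_2 = const, s_3 = b / T. If i <= n - 2, its six
   rational points at infinity do not differ by torsion only, and the group law
   produces a finite rational point over the field generated by the fixed
   coordinates, which can be taken algebraically independent.
   If i = n - 1, dividing by sigma_n turns the system into sum 1/x_j = a/b,
   prod x_j = b. With n - 4 coordinates fixed and the others of the form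
   x, -x, y, z, only a conic with a rational point remains, as long as the sum
   1/y + 1/z is nonzero. It is zero only if n = 4 and a = 0, and then Euler's
   parametrization of x y z (x + y + z) = const applies.
   Replacing the last parameter t by (k + 1) t turns one parametric solution into
   infinitely many. *)
From HB Require Import structures.
Require Import Defs.
From mathcomp Require Import all_boot all_order all_algebra.
From mathcomp Require Import ring zify.

Set Implicit Arguments.
Unset Strict Implicit.
Unset Printing Implicit Defensive.

Import Order.TTheory GRing.Theory Num.Theory.
Local Open Scope ring_scope.

(** * Algebraic independence *)

HB.instance Definition _ m :=
  GRing.RMorphism.copy (@ratfun_const m) (@tofrac {mpoly rat[m]} \o @mpolyC m rat).

Lemma eq_mmap (n : nat) (R S : nzRingType) (f : R -> S) (h h' : 'I_n -> S) :
  h =1 h' -> mmap f h =1 mmap f h'.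
Proof.
move=> hh p; rewrite /mmap; apply: eq_bigr => m _; congr (_ * _).
exact: mmap1_eq.
Qed.

Lemma mvar_neq0 (n : nat) (R : nzRingType) (i : 'I_n) : 'X_i != 0 :> {mpoly R[n]}.
Proof.
apply/eqP => /(congr1 (mcoeff U_(i))); rewrite mcoeffXU eqxx mcoeff0.
by apply/eqP; exact: oner_neq0.
Qed.

(** Evaluating the last variable separately turns a relation among n + 1 elements into a univariate
    equation for the last one. *)
Lemma mmap_muni (n : nat) (R : comNzRingType) (S : comNzRingType)
    (f : {rmorphism R -> S}) (h : 'I_n.+1 -> S) (p : {mpoly R[n.+1]}) :
  mmap f h p
  = (map_poly (mmap f (fun i : 'I_n => h (widen_ord (leqnSn n) i)))
       (muni p)).[h ord_max].
Proof.
rewrite muniE rmorph_sum /= horner_sum; apply: eq_bigr => m _.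
rewrite -mul_polyC -mul_mpolyC !rmorphM /= map_polyXn !map_polyC /=.
rewrite mmapC mmapX !hornerE /mmap1 big_ord_recr /= mulrA; congr (_ * _ * _).
by apply: eq_bigr => i _; rewrite mnmE.
Qed.

Lemma muni_mwiden (m : nat) (R : comNzRingType) (q : {mpoly R[m]}) :
  muni (mwiden q) = q%:P.
Proof.
rewrite [q]mpolyE (raddf_sum (@mwiden m R)) !raddf_sum; apply: eq_bigr => k _.
transitivity (muni (mwiden (q@_k *: 'X_[k]))); first by [].
rewrite mwidenZ mwidenX muniZ muniE msuppX big_seq1 mcoeffX eqxx scale1r.
rewrite mnmwiden_ordmax expr0 -!mul_polyC mulr1 -polyCM mul_mpolyC.
congr (_ *: 'X_[_])%:P; apply/mnmP => i.
by rewrite mnmE mnmwiden_widen.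
Qed.

(* Clearing denominators, only the leading term of Q survives where D vanishes. *)
Lemma root_frac_pole (A : idomainType) (S : nzRingType) (phi : {rmorphism A -> S})
    (Q : {poly A}) (N D : A) :
    D != 0 -> phi D = 0 -> (map_poly (@tofrac A) Q).[tofrac N / tofrac D] = 0 ->
  phi (lead_coef Q) * phi N ^+ (size Q).-1 = 0.
Proof.
move=> D0 phiD Q0.
have [->|Qn0] := eqVneq Q 0; first by rewrite lead_coef0 rmorph0 mul0r.
have sQ : size Q = (size Q).-1.+1 by rewrite prednK // size_poly_gt0.
have D0' : tofrac D != 0 by rewrite tofrac_eq0.
suff : \sum_(i < size Q) Q`_i * N ^+ i * D ^+ ((size Q).-1 - i) = 0.
  move/(congr1 phi); rewrite rmorph_sum rmorph0 sQ big_ord_recr /= subnn mulr1.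
  rewrite rmorphM rmorphXn -lead_coefE big1 ?add0r // => i _.
  rewrite rmorphM [phi (D ^+ _)]rmorphXn phiD expr0n.
  by rewrite subn_eq0 leqNgt ltn_ord mulr0.
apply/eqP; rewrite -tofrac_eq0 rmorph_sum; apply/eqP.
move: Q0; rewrite horner_coef size_map_inj_poly ?rmorph0 //; last first.
  by move=> u v /eqP; rewrite tofrac_eq => /eqP.
move/(congr1 (fun z => z * tofrac D ^+ (size Q).-1)); rewrite mul0r mulr_suml.
apply: etrans; apply: eq_bigr => i _.
rewrite coef_map /= 2!rmorphM !rmorphXn -!mulrA; congr (_ * _).
rewrite expr_div_n -mulrA; congr (_ * _).
have le_i : (i <= (size Q).-1)%N by rewrite -ltnS -sQ.
rewrite -{2}(subnK le_i) exprD mulrCA mulVf ?mulr1 //.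
by rewrite expf_neq0.
Qed.

Lemma mmap_const_widen (m : nat) (q : {mpoly rat[m]}) :
  mmap (@ratfun_const m.+1) (fun i => tofrac 'X_(widen_ord (leqnSn m) i)) q
  = tofrac (mwiden q).
Proof.
rewrite /mwiden /mmap rmorph_sum; apply: eq_bigr => k _.
rewrite rmorphM rmorph_prod; congr (_ * _).
by apply: eq_bigr => i _; rewrite rmorphXn.
Qed.

(* (muni D).[0] is D with its last variable set to 0. *)
Lemma independent_of_pole (m : nat) (y : 'I_m.+1 -> ratfun m.+1)
    (N D : {mpoly rat[m.+1]}) :
    (forall i : 'I_m,
       y (widen_ord (leqnSn m) i) = tofrac 'X_(widen_ord (leqnSn m) i)) ->
    y ord_max = tofrac N / tofrac D -> D != 0 ->
    (muni D).[0] = 0 -> (muni N).[0] != 0 ->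
  alg_independent y.
Proof.
move=> y_widen y_max D0 D00 N00 p.
rewrite (mmap_muni (@ratfun_const m.+1) y) y_max.
set g := mmap _ _; have gE q : g q = tofrac (mwiden q).
  by rewrite /g (eq_mmap _ y_widen) mmap_const_widen.
pose pbar := map_poly (@mwiden m rat) (muni p).
have -> : map_poly g (muni p) = map_poly (@tofrac _) pbar.
  by rewrite -map_poly_comp; apply: eq_map_poly => q; rewrite /= gE.
(* Setting the last variable to 0 leaves the coefficients of the relation unchanged, since they only
   involve the first m variables. As N does not vanish there, the leading coefficient must. *)
move=> /(root_frac_pole (phi := horner_eval 0 \o @muni m rat) D0 D00).
rewrite /= lead_coef_map_inj ?rmorph0 //; last exact: inj_mwiden.
rewrite /horner_eval muni_mwiden hornerC => /eqP.
rewrite mulf_eq0 expf_eq0 (negPf N00) andbF orbF lead_coef_eq0 => /eqP p0.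
rewrite -[p]comp_mpoly_id /comp_mpoly mmap_muni p0.
by rewrite rmorph0 horner0.
Qed.

(** * Elementary symmetric functions of a sequence *)

(** On sequences the unknown coordinates can be consed one by one to the fixed ones; the generating
    polynomial makes each cons a two-term recursion. *)
Definition elemsym (R : comNzRingType) (s : seq R) (k : nat) : R :=
  (\prod_(x <- s) (1 + x *: 'X))`_k.

Section ElementarySymmetric.
Variable R : comNzRingType.
Implicit Types (x : R) (s : seq R).

Lemma elemsym0 s : elemsym s 0 = 1.
Proof.
elim: s => [|x s IHs]; rewrite /elemsym ?big_nil ?coef1 // big_cons.
by rewrite mulrDl mul1r coefD -/(elemsym s 0) IHs -scalerAl coefZ coefXM mulr0 addr0.
Qed.

Lemma elemsym_consS x s k : elemsym (x :: s) k.+1 = elemsym s k.+1 + x * elemsym s k.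
Proof. by rewrite /elemsym big_cons mulrDl mul1r coefD -scalerAl coefZ coefXM. Qed.

Lemma elemsym_gt_size s k : (size s < k)%N -> elemsym s k = 0.
Proof.
elim: s k => [|x s IHs] [|k] //= lt_sk; first by rewrite /elemsym big_nil coef1.
by rewrite elemsym_consS !IHs ?mulr0 ?addr0 // ltnW.
Qed.

Lemma elemsym_size s : elemsym s (size s) = \prod_(x <- s) x.
Proof.
elim: s => [|x s IHs]; first by rewrite elemsym0 big_nil.
by rewrite elemsym_consS elemsym_gt_size //= IHs big_cons add0r.
Qed.

Lemma elemsym_nseq x n k : elemsym (nseq n x) k = x ^+ k *+ 'C(n, k).
Proof.
elim: n k => [|n IHn] [|k]; rewrite ?elemsym0 ?bin0 //.
  by rewrite elemsym_gt_size.
by rewrite /= elemsym_consS !IHn binS mulrnDr mulrnAr -exprS.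
Qed.

(** The product of the 1 + h_j X expands over subsets J of the indices, and the coefficient of X^k
    retains those with k elements. *)
Lemma mmap_mesym (n k : nat) (R0 : comNzRingType) (f : {rmorphism R0 -> R})
    (h : 'I_n -> R) :
  mmap f h (mesym n R0 k) = elemsym (map h (enum 'I_n)) k.
Proof.
rewrite /elemsym big_map big_enum /= /mesym raddf_sum /=.
under [in RHS]eq_bigr do rewrite addrC.
rewrite bigA_distr coef_sum /= [LHS]big_mkcond; apply: eq_bigr => J _.
rewrite rmorph_prod /= -big_mkcond /=.
under [in LHS]eq_bigr do rewrite mmapX mmap1U.
under [in RHS]eq_bigr do rewrite -mul_polyC.
rewrite big_split /= -rmorph_prod prodr_const coefCM coefXn eq_sym.
by case: eqP => _; rewrite ?mulr1 ?mulr0.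
Qed.

End ElementarySymmetric.

Lemma elemsym_pred_size (F : fieldType) (x : F) (s : seq F) :
    0 \notin x :: s ->
  elemsym (x :: s) (size s) = (\prod_(y <- x :: s) y) * \sum_(y <- x :: s) y^-1.
Proof.
elim: s x => [|y s IHs] x /=.
  by rewrite inE eq_sym elemsym0 !big_seq1 => x0; rewrite divff.
rewrite inE negb_or eq_sym => /andP[x0 ys0].
rewrite elemsym_consS -[(size s).+1]/(size (y :: s)) elemsym_size IHs //.
rewrite [in RHS]big_cons.
rewrite [in RHS](big_cons _ _ x (y :: s)) mulrDr mulrAC divff // mul1r.
by rewrite mulrA.
Qed.

Lemma map_ffun_nth (T : Type) (n : nat) (x0 : T) (s : seq T) :
  size s = n -> map [ffun i : 'I_n => nth x0 s i] (enum 'I_n) = s.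
Proof.
move=> <-; rewrite -[RHS](mkseq_nth x0) /mkseq -val_enum_ord -map_comp.
by apply: eq_map => i /=; rewrite ffunE.
Qed.

Lemma sigma_ffun_nth (F : fieldType) (n k : nat) (s : seq F) :
  size s = n -> sigma k [ffun i : 'I_n => nth 0 s i] = elemsym s k.
Proof. by move=> sz; rewrite /sigma /meval mmap_mesym map_ffun_nth. Qed.

(** * The case i <= n - 2 *)

(** For consecutive coefficients p, q, r and m = k + e + 1, the recurrences (k+1) q = (e+1) p and
    (k+2) r = e q give (e+1)(k+2) p r = (k+1) e q^2, where (k+1) e < (e+1)(k+2). *)
Lemma bin_log_concave (m k : nat) :
  (k < m)%N -> ('C(m, k) * 'C(m, k.+2) < 'C(m, k.+1) ^ 2)%N.
Proof.
move=> lt_km; have := mul_bin_left m k; have := mul_bin_left m k.+1.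
have : (0 < 'C(m, k.+1))%N by rewrite bin_gt0.
have : (0 < 'C(m, k))%N by rewrite bin_gt0 ltnW.
move: 'C(m, k) 'C(m, k.+1) 'C(m, k.+2) => p q r p0 q0 qr pq.
have [e em] : exists e, (m = k + e.+1)%N by exists (m - k.+1)%N; lia.
rewrite em in qr pq.
have {}qr : (k.+2 * r = e * q)%N by rewrite qr; congr (_ * _)%N; lia.
have {}pq : (k.+1 * q = e.+1 * p)%N by rewrite pq; congr (_ * _)%N; lia.
rewrite -(ltn_pmul2l (m := e.+1 * k.+2)) //.
have -> : (e.+1 * k.+2 * (p * r) = (e.+1 * p) * (k.+2 * r))%N by lia.
rewrite -pq qr.
have -> : (k.+1 * q * (e * q) = (k.+1 * e) * q ^ 2)%N by lia.
by rewrite ltn_pmul2r ?expn_gt0 ?q0 //; lia.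
Qed.

(* With A, B, E, G = e_(i-1), e_(i-2), e_i, e_(i-3) this is T A^3 (u + c + v d)
   for the invariants c, d of the cubic rescaled to s_1 + s_2 = c, s_3 = d. *)
Definition cubic_factor (R : comNzRingType) (a b T A B E G u v : R) : R :=
  u * (T * A ^+ 3) + (a * T - T * E - b * G) * A * B + v * b * B ^+ 3.

(* The points at infinity of the cubic are the six permutations of
   (oo, -A/B, 0); they form two cosets of a subgroup of order 3, and the point
   below is 2 P - Q for P, Q in distinct cosets. *)
Lemma cubic_point (F : fieldType) (a b T A B E G : F)
    (n1 := b * B ^+ 3 - T * A ^+ 3)
    (n2 := cubic_factor a b T A B E G 2 1) (n3 := cubic_factor a b T A B E G 1 2)
    (x := - (b * B ^+ 2 * n2) / (T * A ^+ 2 * n3))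
    (y := - (A * n3) / (B * n1)) (z := (A * n1) / (B * n2)) :
    T != 0 -> A != 0 -> B != 0 -> n1 != 0 -> n2 != 0 -> n3 != 0 ->
  E + A * (x + y + z) + B * (x * y + y * z + z * x) + G * (x * y * z) = a
  /\ T * (x * y * z) = b.
Proof.
move=> T0 A0 B0 n10 n20 n30; split; last first.
  by rewrite /x /y /z; field; rewrite T0 A0 B0 n10 n20 n30.
rewrite /x /y /z; move: n10 n20 n30; rewrite /n1 /n2 /n3 /cubic_factor !mul1r.
by move=> n10 n20 n30; field; rewrite T0 A0 B0 n10 n20 n30.
Qed.

(* The substitution of X for all fixed coordinates gives this shape with
   Y = X^r, W = X^(r-1), r = i - 2; the coefficient of X^(3 r) is then nonzero by
   log-concavity of the binomial coefficients. *)
Lemma cubic_factor_neq0 (Y W Q : {poly rat}) (a b al be ep ga u v : rat) :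
    Y != 0 -> 'X * (ga%:P * W) = ga%:P * Y ->
    b != 0 -> be != 0 -> v * be ^+ 2 != ga * al ->
  cubic_factor a%:P b%:P ('X * Y * Q) (al%:P * ('X * Y)) (be%:P * Y)
    (ep%:P * ('X ^+ 2 * Y)) (ga%:P * W) u%:P v%:P != 0.
Proof.
move=> Y0 WY b0 be0 nz.
pose lead := b * be * (v * be ^+ 2 - ga * al).
pose tail := (u * al ^+ 3)%:P * 'X ^+ 3 * Y * Q
  + (a%:P - ep%:P * 'X ^+ 2 * Y) * Q * (al * be)%:P * 'X.
have -> : cubic_factor a%:P b%:P ('X * Y * Q) (al%:P * ('X * Y)) (be%:P * Y)
    (ep%:P * ('X ^+ 2 * Y)) (ga%:P * W) u%:P v%:P
  = Y ^+ 3 * (lead%:P + tail * 'X).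
  rewrite /cubic_factor.
  (* The term in W has one factor X too few for Y^3; it takes the X contained in A. *)
  have -> : (a%:P * ('X * Y * Q) - 'X * Y * Q * (ep%:P * ('X ^+ 2 * Y))
             - b%:P * (ga%:P * W)) * (al%:P * ('X * Y)) * (be%:P * Y)
    = ((a%:P * ('X * Y * Q) - 'X * Y * Q * (ep%:P * ('X ^+ 2 * Y))) * 'X
       - b%:P * ('X * (ga%:P * W))) * al%:P * be%:P * Y ^+ 2 by ring.
  rewrite WY /lead /tail !(polyCM, polyCB, rmorphXn) /=; ring.
rewrite mulf_neq0 ?expf_neq0 //; apply/eqP => /polyP/(_ 0%N).
rewrite coefD coefC coefMX addr0 coef0; apply/eqP.
by rewrite !mulf_neq0 // subr_eq0.
Qed.

Lemma rmorph_cubic_factor (R S : comNzRingType) (f : {rmorphism R -> S})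
    (a b T A B E G u v : R) :
  f (cubic_factor a b T A B E G u v)
  = cubic_factor (f a) (f b) (f T) (f A) (f B) (f E) (f G) (f u) (f v).
Proof. by rewrite /cubic_factor !(rmorphD, rmorphN, rmorphM, rmorphXn). Qed.

(** This substitution serves below to show that polynomials in the fixed coordinates are nonzero. *)
Lemma mmap_mesym_X (M k : nat) :
  mmap polyC (fun=> 'X) (mesym M rat k) = ('C(M, k)%:R : rat)%:P * 'X ^+ k.
Proof.
have -> : ('C(M, k)%:R : rat)%:P * 'X ^+ k = 'X ^+ k *+ 'C(M, k).
  by rewrite mul_polyC scaler_nat.
rewrite mmap_mesym -elemsym_nseq.
suff -> : [seq 'X | _ <- enum 'I_M] = nseq M ('X : {poly rat}) by [].
by rewrite -[in RHS](size_enum_ord M); elim: (enum _) => //= i s ->.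
Qed.

(* The elementary symmetric polynomial of degree r - 1, which is 0 for r = 0. *)
Definition mesym_pred (M r : nat) : {mpoly rat[M]} :=
  if r is j.+1 then mesym M rat j else 0.

Lemma mesym_neq0 (M k : nat) : (k <= M)%N -> mesym M rat k != 0.
Proof.
move=> le_kM; apply: contra_neq (_ : mmap polyC (fun=> 'X) (mesym M rat k) != 0).
  by move=> ->; rewrite rmorph0.
rewrite mmap_mesym_X mulf_neq0 ?expf_neq0 ?polyX_eq0 //.
by rewrite polyC_eq0 pnatr_eq0 -lt0n bin_gt0.
Qed.

(** Only v = 1 and v = 2 are needed; v >= 1 preserves the strict inequality C(M,r-1) C(M,r+1) <
    C(M,r)^2. *)
Lemma mesym_cubic_factor_neq0 (M r : nat) (a b u v : rat) :
    (r < M)%N -> b != 0 -> 1 <= v ->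
  cubic_factor a%:MP b%:MP (mesym M rat M) (mesym M rat r.+1) (mesym M rat r)
    (mesym M rat r.+2) (mesym_pred M r) u%:MP v%:MP != 0.
Proof.
move=> lt_rM b0 v1; set P := cubic_factor _ _ _ _ _ _ _ _ _.
apply: contra_neq (_ : mmap polyC (fun=> 'X) P != 0).
  by move=> ->; rewrite rmorph0.
have C0 : ('C(M, r)%:R : rat) != 0 by rewrite pnatr_eq0 -lt0n bin_gt0 ltnW.
rewrite rmorph_cubic_factor /= !mmapC !mmap_mesym_X binn mul1r.
have -> : 'X^M = 'X * 'X^r * 'X^(M - r.+1) :> {poly rat}.
  by rewrite -exprS -exprD subnKC.
rewrite exprS (_ : r.+2 = 2 + r)%N // exprD.
case: r lt_rM C0 {P} => [|r] lt_rM C0 /=.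
  (* For r = 0 the coefficient G is 0, read as ga = 0 and W = 0. *)
  rewrite rmorph0 -[X in cubic_factor _ _ _ _ _ _ X](mul0r 0) -[X in X * 0]polyC0.
  apply: cubic_factor_neq0 => //.
  - by rewrite oner_eq0.
  - by rewrite !mul0r mulr0.
  by rewrite mul0r bin0 expr1n mulr1 gt_eqF // (lt_le_trans ltr01).
rewrite mmap_mesym_X; apply: cubic_factor_neq0 => //.
- by rewrite expf_neq0 ?polyX_eq0.
- by rewrite mulrCA -exprS.
rewrite gt_eqF // (lt_le_trans (y := 'C(M, r.+1)%:R ^+ 2)) //.
  by rewrite -natrM -natrX ltr_nat bin_log_concave // ltnW.
by rewrite ler_peMl // exprn_ge0 // ler0n.
Qed.

(** The two terms have different degrees, 3 r and M + 3 (r + 1). *)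
Lemma mesym_cube_sub_neq0 (M r : nat) (b : rat) :
    (r < M)%N -> b != 0 ->
  b%:MP * mesym M rat r ^+ 3 - mesym M rat M * mesym M rat r.+1 ^+ 3 != 0.
Proof.
move=> lt_rM b0; set P := _ - _.
apply: contra_neq (_ : mmap polyC (fun=> 'X) P != 0).
  by move=> ->; rewrite rmorph0.
have C0 : ('C(M, r)%:R : rat) != 0 by rewrite pnatr_eq0 -lt0n bin_gt0 ltnW.
rewrite rmorphB (rmorphM _ b%:MP) (rmorphM _ (mesym M rat M)) !rmorphXn /=.
rewrite !mmapC !mmap_mesym_X !exprMn -!exprM.
rewrite -!rmorphXn; apply/eqP => /polyP/(_ (r * 3)%N); rewrite coefB coef0 -mulrA.
rewrite !coefCM coefXnM !coefCM !coefXn eqxx (_ : _ == _ = false); last first.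
  by apply/eqP; lia.
rewrite !mulr0 if_same mulr0 subr0 mulr1; apply/eqP.
by rewrite mulf_neq0 // rmorphXn expf_neq0.
Qed.

(** Algebraic independence reduces the nonvanishing of the denominators in [cubic_point] to that of
    polynomials; r < M keeps e_(r+1) nonzero. *)
Lemma cubic_solution (m M r : nat) (a b : rat) (t : 'I_M -> ratfun m)
    (ts := map t (enum 'I_M)) :
    alg_independent t -> (r < M)%N -> b != 0 ->
  exists x y z, elemsym [:: x, y, z & ts] r.+2 = ratfun_const m a
    /\ \prod_(w <- [:: x, y, z & ts]) w = ratfun_const m b.
Proof.
move=> t_ind lt_rM b0.
have t_neq0 p : p != 0 -> mmap (@ratfun_const m) t p != 0.
  by apply: contra_neq; exact: t_ind.
have t_mesym k : mmap (@ratfun_const m) t (mesym M rat k) = elemsym ts k.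
  exact: mmap_mesym.
have T0 := t_neq0 _ (mesym_neq0 (leqnn M)).
have A0 := t_neq0 _ (mesym_neq0 lt_rM).
have B0 := t_neq0 _ (mesym_neq0 (ltnW lt_rM)).
have n10 := t_neq0 _ (mesym_cube_sub_neq0 lt_rM b0).
have t_const c : mmap (@ratfun_const m) t c%:MP = ratfun_const m c by exact: mmapC.
have t_factor u v : 1 <= v ->
    cubic_factor (ratfun_const m a) (ratfun_const m b) (elemsym ts M) (elemsym ts r.+1)
      (elemsym ts r) (elemsym ts r.+2) (mmap (@ratfun_const m) t (mesym_pred M r))
      (ratfun_const m u) (ratfun_const m v) != 0.
  move=> v1; have := t_neq0 _ (mesym_cubic_factor_neq0 a u lt_rM b0 v1).
  by rewrite rmorph_cubic_factor -!t_mesym -!t_const.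
have n20 := t_factor 2 1 (lexx 1).
have n30 := t_factor 1 2 (ler1n _ 2).
have c1 : ratfun_const m 1 = 1 by exact: rmorph1.
have c2 : ratfun_const m 2 = 2 by exact: rmorph_nat.
rewrite c1 c2 in n20 n30.
rewrite rmorphB (rmorphM _ b%:MP) (rmorphM _ (mesym M rat M)) !rmorphXn in n10.
rewrite /= !t_mesym t_const in n10.
rewrite !t_mesym in T0 A0 B0.
have [eq_a eq_b] := cubic_point T0 A0 B0 n10 n20 n30.
move: eq_a eq_b; set x := - _ / _; set y := - _ / _; set z := _ / _ => eq_a eq_b.
exists x, y, z; split.
  rewrite -eq_a !elemsym_consS; clearbody x y z; clear -t_mesym.
  case: r => [|r] /=; first by rewrite !elemsym0 rmorph0; ring.
  by rewrite t_mesym !elemsym_consS; ring.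
have sz : size ts = M by rewrite size_map size_enum_ord.
by rewrite !big_cons -elemsym_size sz -eq_b; ring.
Qed.

(** * From one solution to infinitely many *)

(** The last hypothesis is a cross-multiplied equality of two fractions with a pole of order e. Once
    X^e is cancelled, [phi] leaves only (l+1)^e = (k+1)^e. *)
Lemma pole_scaling_inj (A B : idomainType) (phi : {rmorphism A -> B})
    (e k l : nat) (X : A) (N D : nat -> A) (n0 d0 : B) :
    injective (fun n => n%:R : B) -> X != 0 -> (0 < e)%N -> n0 != 0 -> d0 != 0 ->
    (forall k, phi (N k) = n0) -> (forall k, phi (D k) = d0) ->
    N k * ((l.+1%:R * X) ^+ e * D l) = N l * ((k.+1%:R * X) ^+ e * D k) ->
  k = l.
Proof.
move=> nat_inj X0 e0 n00 d00 phiN phiD; rewrite !exprMn => eq_kl.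
have {}eq_kl : N k * (l.+1%:R ^+ e * D l) = N l * (k.+1%:R ^+ e * D k).
  apply: (mulfI (expf_neq0 e X0)).
  have swap (x y u v : A) : x * (y * (u * v)) = y * (u * x * v) by ring.
  by rewrite !swap.
move/(congr1 phi): eq_kl; rewrite !rmorphM !rmorphXn !rmorph_nat !phiN !phiD -!natrX.
by move/(mulfI n00)/(mulIf d00)/nat_inj/eqP; rewrite eqn_exp2r // eqSS => /eqP.
Qed.

Section Family.
Variable m : nat.

Definition last_param (k : nat) : {mpoly rat[m.+1]} := k.+1%:R * 'X_ord_max.

Definition coords (w : ratfun m.+1) : seq (ratfun m.+1) :=
  rcons [seq tofrac 'X_(widen_ord (leqnSn m) i) | i <- enum 'I_m] w.

Lemma muni_X_max : muni ('X_ord_max : {mpoly rat[m.+1]}) = 'X.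
Proof.
rewrite muniE msuppX big_seq1 mcoeffX eqxx scale1r mnm1E eqxx expr1.
rewrite (_ : [multinom _ | _ < _] = 0%MM) ?mpolyX0 ?scale1r //.
by apply/mnmP => i; rewrite mnmE mnm1E mnm0E -val_eqE /= gtn_eqF.
Qed.

Lemma muni_last_param k : (muni (last_param k)).[0] = 0.
Proof. by rewrite /last_param muniM muni_X_max hornerMX mulr0. Qed.

Lemma last_param_neq0 k : last_param k != 0.
Proof.
rewrite mulf_neq0 ?mvar_neq0 //.
by rewrite -(rmorph_nat (@mpolyC m.+1 rat)) mpolyC_eq0 pnatr_eq0.
Qed.

Lemma muni_neq0 (p : {mpoly rat[m.+1]}) : (muni p).[0] != 0 -> p != 0.
Proof. by apply: contra_neq => ->; rewrite muni0 horner0. Qed.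

Section Poles.
Variables (e : nat) (N D : nat -> {mpoly rat[m.+1]}) (n0 d0 : {mpoly rat[m]}).
Hypotheses (e_gt0 : (0 < e)%N) (n0_neq0 : n0 != 0) (d0_neq0 : d0 != 0).
Hypotheses (muniN : forall k, (muni (N k)).[0] = n0).
Hypotheses (muniD : forall k, (muni (D k)).[0] = d0).
(** Each of the three cases has a coordinate of this form. Its leading coefficient at the pole
    depends on k only through (k+1)^e, which separates the solutions; the pole itself gives
    independence. *)
Let w k : ratfun m.+1 := tofrac (N k) / tofrac (last_param k ^+ e * D k).

Let den_neq0 k : last_param k ^+ e * D k != 0.
Proof. by rewrite mulf_neq0 ?expf_neq0 ?last_param_neq0 // muni_neq0 ?muniD. Qed.

Lemma pole_inj : injective w.
Proof.
move=> k l /eqP; rewrite /w eqr_div ?tofrac_eq0 // -!tofracM tofrac_eq => /eqP.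
apply: (pole_scaling_inj (phi := horner_eval 0 \o @muni m rat)) => //.
- move=> p q; rewrite -!(rmorph_nat (@mpolyC m rat)) => /(can_inj (@mpolyCK m rat))/eqP.
  by rewrite eqr_nat => /eqP.
- exact: mvar_neq0.
- exact: n0_neq0.
- exact: d0_neq0.
- exact: muniN.
- exact: muniD.
Qed.

Lemma coords_independent k :
  alg_independent (fun j : 'I_m.+1 => nth 0 (coords (w k)) j).
Proof.
apply: (@independent_of_pole _ _ (N k) (last_param k ^+ e * D k)) => //.
- move=> i; rewrite nth_rcons size_map size_enum_ord /= ltn_ord.
  by rewrite (nth_map i) ?size_enum_ord // nth_ord_enum.
- by rewrite nth_rcons size_map size_enum_ord /= ltnn eqxx.
- exact: den_neq0.
- rewrite -[e]prednK // exprS -mulrA (muniM (last_param k)) hornerM.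
  by rewrite [X in X * _](muni_last_param k) mul0r.
by rewrite muniN.
Qed.

Lemma family_of_poles (i : nat) (a b : rat) :
    (forall k, exists x y z, let s := [:: x, y, z & coords (w k)] in
       elemsym s i = ratfun_const m.+1 a /\ \prod_(c <- s) c = ratfun_const m.+1 b) ->
  exists X : nat -> {ffun 'I_m.+4 -> ratfun m.+1},
    injective X /\
    forall k : nat,
      parametric_solution i a b (X k) /\ depends_on_all_parameters (X k).
Proof.
move=> sol.
have sz k : size (coords (w k)) = m.+1 by rewrite size_rcons size_map size_enum_ord.
(* Phrased with boolean equality, the existence of x, y, z for each k yields a function of k through
   [xchoose]. *)
pose good k (t : ratfun m.+1 * ratfun m.+1 * ratfun m.+1) :=
  let s := [:: t.1.1, t.1.2, t.2 & coords (w k)] in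
  (elemsym s i == ratfun_const m.+1 a) && (\prod_(c <- s) c == ratfun_const m.+1 b).
have goodP k : exists t, good k t.
  have [x [y [z [sa sb]]]] := sol k; exists (x, y, z).
  by apply/andP; split; apply/eqP.
pose s k := let t := xchoose (goodP k) in [:: t.1.1, t.1.2, t.2 & coords (w k)].
have sz_s k : size (s k) = m.+4 by rewrite /= sz.
exists (fun k => [ffun j : 'I_m.+4 => nth 0 (s k) j]); split.
  move=> k l /ffunP/(_ ord_max); rewrite !ffunE /= !nth_rcons.
  by rewrite size_map size_enum_ord ltnn eqxx; exact: pole_inj.
move=> k; have /andP[/eqP sa /eqP sb] := xchooseP (goodP k); split.
  split; rewrite sigma_ffun_nth //.
  by rewrite -{1}(sz_s k) elemsym_size.
(* The shift skips x, y, z and selects the m + 1 independent coordinates. *)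
exists (@rshift 3 m.+1) => p p0; apply: (coords_independent (k := k)); rewrite -[RHS]p0.
by apply: eq_mmap => j /=; rewrite ffunE.
Qed.
End Poles.
End Family.

(** * The three cases *)

Lemma middle_case (m r : nat) (a b : rat) : (r <= m)%N -> b != 0 ->
  exists X : nat -> {ffun 'I_m.+4 -> ratfun m.+1},
    injective X /\
    forall k : nat,
      parametric_solution r.+2 a b (X k) /\ depends_on_all_parameters (X k).
Proof.
move=> le_rm b0; have muni1 (k : nat) : (muni (1 : {mpoly rat[m.+1]})).[0] = 1.
  by rewrite rmorph1 hornerC.
(* The last fixed coordinate is 1 / t: a simple pole, with N = D = 1. *)
apply: (family_of_poles (ltn0Sn 0) (oner_neq0 _) (oner_neq0 _) muni1 muni1) => k /=.
set w := _ / _.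
have w_ind := coords_independent (ltn0Sn 0) (oner_neq0 _) (oner_neq0 _) muni1 muni1
  (k := k).
have [x [y [z sol]]] := cubic_solution a w_ind (ltnSE le_rm) b0.
exists x, y, z; move: sol.
suff -> : [seq nth 0 (coords w) (j : 'I_m.+1) | j <- enum 'I_m.+1] = coords w by [].
rewrite -[RHS](mkseq_nth 0) /mkseq size_rcons size_map size_enum_ord.
by rewrite -val_enum_ord -map_comp.
Qed.

(** * The case i = n - 1 through sums of reciprocals *)

Lemma elemsym_of_inverses (F : fieldType) (al be : F) (x : F) (s : seq F) :
    \prod_(c <- x :: s) c = be -> be != 0 -> \sum_(c <- x :: s) c^-1 = al / be ->
  elemsym (x :: s) (size s) = al.
Proof.
move=> prodE be0 sumE.
(* A zero entry would have inverse 0 by convention; the nonzero product excludes it. *)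
have nz : 0 \notin x :: s.
  apply: contraNN be0 => in0; rewrite -prodE prodf_seq_eq0.
  by apply/hasP; exists 0 => //=.
by rewrite elemsym_pred_size // prodE sumE mulrC divfK.
Qed.

Lemma sum_inverses (F : fieldType) (s : seq F) : 0 \notin s ->
  \sum_(c <- s) c^-1 = (if size s is j.+1 then elemsym s j else 0) / \prod_(c <- s) c.
Proof.
case: s => [|x s] nz /=; first by rewrite big_nil mul0r.
rewrite elemsym_pred_size // mulrAC divff ?mul1r //.
by rewrite prodf_seq_neq0; apply/allP => c cs; apply: contraNneq nz => <-.
Qed.

Section InverseCase.
Variable m : nat.
Let ts : seq (ratfun m.+1) :=
  [seq tofrac 'X_(widen_ord (leqnSn m) i) | i <- enum 'I_m].

Lemma elemsym_params k : elemsym ts k = tofrac (mwiden (mesym m rat k)).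
Proof.
rewrite -(mmap_mesym _ (@ratfun_const m.+1)).
exact: mmap_const_widen.
Qed.

Lemma size_params : size ts = m.
Proof. by rewrite size_map size_enum_ord. Qed.

Lemma prod_params : \prod_(c <- ts) c = tofrac (mwiden (mesym m rat m)).
Proof. by rewrite -elemsym_params -elemsym_size size_params. Qed.

Lemma sum_inv_params :
  \sum_(c <- ts) c^-1
  = tofrac (mwiden (mesym_pred m m)) / tofrac (mwiden (mesym m rat m)).
Proof.
rewrite sum_inverses; last first.
  by apply/mapP => -[i _ /eqP]; rewrite eq_sym tofrac_eq0; apply/negP; exact: mvar_neq0.
rewrite prod_params size_params /mesym_pred; congr (_ / _).
suff coefE M : (if M is j.+1 then elemsym ts j else 0)
    = tofrac (mwiden (if M is j.+1 then mesym m rat j else 0)) by exact: coefE.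
by case: M => [|j]; rewrite ?mwiden0 ?rmorph0 // elemsym_params.
Qed.

End InverseCase.

(* P / T is the sum of 1/y and 1/w, and T the product of the fixed coordinates; the
   parameter th comes from the conic (P/T)^2 + 4 (T/b) x^2 = square. *)
Lemma inverse_point (F : fieldType) (b T P th S : F)
    (x := P * th * b / (T * (T - b * th ^+ 2))) (y := (T - b * th ^+ 2) / P)
    (w := (th * (th * (b * T)) - T * T) / (th ^+ 2 * (b * P))) :
    b != 0 -> T != 0 -> P != 0 -> th != 0 -> T - b * th ^+ 2 != 0 ->
  x * (- x * (y * (T * w))) = b /\
  x^-1 + ((- x)^-1 + (y^-1 + (S - P / T + w^-1))) = S.
Proof.
move=> b0 T0 P0 th0 d0.
have d0' : th * (th * (b * T)) - T * T != 0.
  rewrite (_ : _ - _ = - (T * (T - b * th ^+ 2))); last by ring.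
  by rewrite oppr_eq0 mulf_neq0.
rewrite /x /y /w; split; field.
  by rewrite b0 T0 P0 th0 d0.
by rewrite b0 T0 P0 th0 d0 d0' oppr_eq0 !mulf_neq0.
Qed.

(** With X for all variables, the coefficient of X^(m-1) is -m if m > 0; for m = 0 the polynomial is
    the constant c. The exception m = 0, c = 0 is left to Euler's parametrization. *)
Lemma reciprocal_sum_neq0 (m : nat) (c : rat) : (0 < m)%N || (c != 0) ->
  c%:MP * mesym m rat m - mesym_pred m m != 0.
Proof.
move=> mc; set P := _ - _.
apply: contra_neq (_ : mmap polyC (fun=> 'X) P != 0).
  by move=> ->; rewrite rmorph0.
rewrite rmorphB (rmorphM _ c%:MP) /= mmapC mmap_mesym_X binn mul1r.
case: m mc {P} => [|j] /= mc; first by rewrite rmorph0 expr0 mulr1 subr0 polyC_eq0.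
rewrite mmap_mesym_X; apply/eqP => /polyP/(_ j).
rewrite coefB !coefCM !coefXn eqxx coef0 ltn_eqF // mulr0 sub0r mulr1 => /eqP.
by rewrite oppr_eq0 pnatr_eq0 -leqn0 leqNgt bin_gt0 leqnSn.
Qed.

Lemma penultimate_case (m : nat) (a b : rat) : b != 0 -> (0 < m)%N || (a != 0) ->
  exists X : nat -> {ffun 'I_m.+4 -> ratfun m.+1},
    injective X /\
    forall k : nat,
      parametric_solution m.+3 a b (X k) /\ depends_on_all_parameters (X k).
Proof.
move=> b0 ma; have := @reciprocal_sum_neq0 m (a / b).
rewrite mulf_eq0 invr_eq0 (negPf b0) orbF => /(_ ma).
set P := _ - _ => P0.
have T0 := mesym_neq0 (leqnn m); set T := mesym _ _ _ in T0.
(* With th = t, the coordinate w of [inverse_point] has a double pole at t = 0: its numerator N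
   becomes -T^2 there, and b P does not involve t. *)
pose N k := last_param m k * (last_param m k * mwiden (b%:MP * T)) - mwiden (T * T).
have muniN k : (muni (N k)).[0] = - (T * T).
  rewrite /N muniB (muniM (last_param m k)) !hornerE.
  by rewrite [X in X * _](muni_last_param m k) mul0r add0r muni_mwiden hornerC.
have muniD (k : nat) : (muni (mwiden (b%:MP * P))).[0] = b%:MP * P.
  by rewrite muni_mwiden hornerC.
have TT0 : - (T * T) != 0 by rewrite oppr_eq0 mulf_neq0.
have bP0 : b%:MP * P != 0 by rewrite mulf_neq0 ?mpolyC_eq0.
apply: (family_of_poles (e := 2) isT TT0 bP0 muniN muniD) => k.
have mwiden_nz q : q != 0 -> tofrac (mwiden q) != 0 :> ratfun m.+1.
  by move=> q0; rewrite tofrac_eq0 -(mwiden0 m rat) (inj_eq (@inj_mwiden _ _)).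
have tb : tofrac (mwiden b%:MP_[m]) = ratfun_const m.+1 b by rewrite mwidenC.
have fb0 : ratfun_const m.+1 b != 0 by rewrite fmorph_eq0.
have th0 : tofrac (last_param m k) != 0 by rewrite tofrac_eq0 last_param_neq0.
have NE : tofrac (N k) = tofrac (last_param m k) * (tofrac (last_param m k)
      * (ratfun_const m.+1 b * tofrac (mwiden T)))
    - tofrac (mwiden T) * tofrac (mwiden T).
  by rewrite /N !mwidenM tofracB !tofracM tb.
have d0 : tofrac (mwiden T) - ratfun_const m.+1 b * tofrac (last_param m k) ^+ 2 != 0.
  apply/eqP => d0; have : tofrac (N k) = 0.
    rewrite NE; set t := tofrac (mwiden T) in d0 *; set th := tofrac _ in d0 *.
    transitivity (- (t * (t - ratfun_const m.+1 b * th ^+ 2))); first by ring.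
    by rewrite d0 mulr0 oppr0.
  by apply/eqP; rewrite tofrac_eq0 muni_neq0 ?muniN.
have [] := inverse_point (ratfun_const m.+1 (a / b)) fb0
  (mwiden_nz _ T0) (mwiden_nz _ P0) th0 d0.
set x := _ / _; set y := _ / _; set w := _ / _ => prodE sumE.
have wE : tofrac (N k) / tofrac (last_param m k ^+ 2 * mwiden (b%:MP * P)) = w.
  rewrite NE mwidenM (tofracM (last_param m k ^+ 2)) (tofracM (mwiden b%:MP)).
  by rewrite tb tofracXn.
exists x, (- x), y; rewrite wE /=.
have prod_b : \prod_(c <- [:: x, - x, y & coords w]) c = ratfun_const m.+1 b.
  by rewrite !big_cons big_rcons /= prod_params -prodE; ring.
split=> //; rewrite (_ : m.+3 = size [:: - x, y & coords w]); last first.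
  by rewrite /= size_rcons size_map size_enum_ord.
apply: (elemsym_of_inverses prod_b) => //.
have -> : ratfun_const m.+1 a / ratfun_const m.+1 b = ratfun_const m.+1 (a / b).
  by rewrite fmorph_div.
rewrite -sumE !big_cons big_rcons /= sum_inv_params.
have -> : tofrac (mwiden P) = ratfun_const m.+1 (a / b) * tofrac (mwiden T)
    - tofrac (mwiden (mesym_pred m m)).
  by rewrite /P mwidenB mwidenM tofracB (tofracM (mwiden (a / b)%:MP)) mwidenC.
by rewrite mulrBl mulfK ?mwiden_nz // subKr.
Qed.

(** * Euler's parametrization: n = 4, i = 3, a = 0 *)

Definition euler_u (R : comNzRingType) (al t : R) : R := 4 * al * t ^+ 4 + 1.
Definition euler_v (R : comNzRingType) (al t : R) : R :=
  2 * al ^+ 2 * t ^+ 8 + 10 * al * t ^+ 4 - 1.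
Definition euler_w (R : comNzRingType) (al t : R) : R := al * t ^+ 4 - 2.

(* The reciprocals of x1, x2, x3 are Euler's solution of p q r (p + q + r) = al. *)
Lemma euler_point (F : fieldType) (al t : F)
    (u := euler_u al t) (v := euler_v al t) (w := euler_w al t)
    (x1 := (u * v) / (t ^+ 3 * (6 * al * w ^+ 2)))
    (x2 := (2 * t * w * v) / (3 * u ^+ 2))
    (x3 := (3 * t * u) / (2 * v)) (x4 := - (6 * t * w) / v) :
    (6 : F) != 0 -> al != 0 -> t != 0 -> u != 0 -> v != 0 -> w != 0 ->
  x2 * (x3 * (x4 * x1)) = - al^-1 /\ x2^-1 + (x3^-1 + (x4^-1 + x1^-1)) = 0.
Proof.
move=> six0; have : (2 * 3 : F) != 0 by rewrite (_ : 2 * 3 = 6) //; ring.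
rewrite mulf_eq0 negb_or => /andP[two0 three0] al0 t0 u0 v0 w0.
rewrite /x1 /x2 /x3 /x4; split.
  by field; rewrite al0 w0 six0 t0 v0 two0 u0 three0.
have w0' : - (6 * t * w) != 0 by rewrite oppr_eq0 !mulf_neq0.
move: u0 v0 w0 w0'; rewrite /u /v /w /euler_u /euler_v /euler_w => u0 v0 w0 w0'.
by field; rewrite w0 al0 six0 t0 v0 u0 w0' two0 three0.
Qed.

Section EulerMorphism.
Variables (R S : comNzRingType) (f : {rmorphism R -> S}) (al t : R).

Lemma rmorph_euler_u : f (euler_u al t) = euler_u (f al) (f t).
Proof. by rewrite /euler_u !(rmorphD, rmorphM, rmorphXn, rmorph1, rmorph_nat). Qed.

Lemma rmorph_euler_v : f (euler_v al t) = euler_v (f al) (f t).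
Proof.
by rewrite /euler_v !(rmorphD, rmorphN, rmorphM, rmorphXn, rmorph1, rmorph_nat).
Qed.

Lemma rmorph_euler_w : f (euler_w al t) = euler_w (f al) (f t).
Proof.
by rewrite /euler_w !(rmorphD, rmorphN, rmorphM, rmorphXn, rmorph1, rmorph_nat).
Qed.

End EulerMorphism.

Lemma euler_u0 (R : comNzRingType) (al : R) : euler_u al 0 = 1.
Proof. by rewrite /euler_u; ring. Qed.

Lemma euler_v0 (R : comNzRingType) (al : R) : euler_v al 0 = -1.
Proof. by rewrite /euler_v; ring. Qed.

Lemma euler_w0 (R : comNzRingType) (al : R) : euler_w al 0 = -2.
Proof. by rewrite /euler_w; ring. Qed.

Lemma euler_case (b : rat) : b != 0 ->
  exists X : nat -> {ffun 'I_4 -> ratfun 1},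
    injective X /\
    forall k : nat,
      parametric_solution 3 0 b (X k) /\ depends_on_all_parameters (X k).
Proof.
(* Euler's p, q, r and -(p + q + r) have sum 0 and product -al, which must be 1/b. *)
move=> b0; pose al : {mpoly rat[1]} := (- b^-1)%:MP.
pose phi : {rmorphism {mpoly rat[1]} -> {mpoly rat[0]}} := horner_eval 0 \o @muni 0 rat.
pose u k := euler_u al (last_param 0 k); pose v k := euler_v al (last_param 0 k).
pose w k := euler_w al (last_param 0 k).
have phi_t k : phi (last_param 0 k) = 0 by exact: muni_last_param.
have phi_al : phi al = (- b^-1)%:MP by rewrite /phi /= /horner_eval muniC hornerC.
have phi_u k : phi (u k) = 1 by rewrite /u rmorph_euler_u phi_t euler_u0.
have phi_v k : phi (v k) = -1 by rewrite /v rmorph_euler_v phi_t euler_v0.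
have phi_w k : phi (w k) = -2 by rewrite /w rmorph_euler_w phi_t euler_w0.
have nat_nz n : (n.+1%:R : {mpoly rat[0]}) != 0.
  by rewrite -(rmorph_nat (@mpolyC 0 rat)) mpolyC_eq0 pnatr_eq0.
have muniN k : (muni (u k * v k)).[0] = -1.
  rewrite -[LHS]/(phi (u k * v k)) rmorphM phi_u phi_v; ring.
have muniD k : (muni (6 * al * w k ^+ 2)).[0] = 6 * (- b^-1)%:MP * (-2) ^+ 2.
  rewrite -[LHS]/(phi (6 * al * w k ^+ 2)) (rmorphM phi (6 * al)) (rmorphM phi 6).
  by rewrite rmorphXn rmorph_nat phi_w phi_al.
have n00 : -1 != 0 :> {mpoly rat[0]} by rewrite oppr_eq0 oner_eq0.
have d00 : 6 * (- b^-1)%:MP * (-2) ^+ 2 != 0 :> {mpoly rat[0]}.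
  by rewrite !mulf_neq0 ?expf_neq0 ?oppr_eq0 ?mpolyC_eq0 ?oppr_eq0 ?invr_eq0 ?nat_nz.
(* The pole coordinate is x1, of order 3: at t = 0, u v is -1 and 6 al w^2 is -24/b. *)
apply: (family_of_poles (e := 3) isT n00 d00 muniN muniD) => k.
have th0 : tofrac (last_param 0 k) != 0 by rewrite tofrac_eq0 last_param_neq0.
have al0 : tofrac al != 0 by rewrite tofrac_eq0 mpolyC_eq0 oppr_eq0 invr_eq0.
have six0 : (6 : ratfun 1) != 0.
  by rewrite -(rmorph_nat (@ratfun_const 1)) fmorph_eq0 pnatr_eq0.
have tofrac_nz p : phi p != 0 -> tofrac p != 0 :> ratfun 1.
  by move=> nz; rewrite tofrac_eq0 muni_neq0.
have u0 : tofrac (u k) != 0 by rewrite tofrac_nz ?phi_u ?oner_eq0.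
have v0 : tofrac (v k) != 0 by rewrite tofrac_nz // phi_v.
have w0 : tofrac (w k) != 0 by rewrite tofrac_nz // phi_w oppr_eq0 nat_nz.
rewrite rmorph_euler_u in u0; rewrite rmorph_euler_v in v0.
rewrite rmorph_euler_w in w0.
have [] := euler_point six0 al0 th0 u0 v0 w0.
rewrite -rmorph_euler_u -rmorph_euler_v -rmorph_euler_w -/(u k) -/(v k) -/(w k).
set z1 := _ / (_ ^+ 3 * _); set z2 := _ / (3 * _); set z3 := _ / (2 * _).
set z4 := _ / _ => prodE sumE.
have -> : tofrac (u k * v k) / tofrac (last_param 0 k ^+ 3 * (6 * al * w k ^+ 2)) = z1.
  rewrite (tofracM (u k)) (tofracM (_ ^+ 3)) (tofracM (6 * al)) (tofracM 6) !tofracXn.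
  by rewrite rmorph_nat.
exists z2, z3, z4; rewrite /coords (_ : enum 'I_0 = [::]) /=; last first.
  by apply: size0nil; rewrite size_enum_ord.
have prod_b : \prod_(c <- [:: z2; z3; z4; z1]) c = ratfun_const 1 b.
  rewrite !big_cons big_nil mulr1 prodE -[tofrac al]/(ratfun_const 1 (- b^-1)).
  by rewrite -fmorphV -rmorphN invrN invrK opprK.
split=> //; apply: (elemsym_of_inverses prod_b); first by rewrite fmorph_eq0.
by rewrite !big_cons big_nil addr0 sumE rmorph0 mul0r.
Qed.

Theorem theorem2 (n i : nat) (a b : rat)
    (hn : (4 <= n)%N) (hi2 : (2 <= i)%N) (hin : (i < n)%N) (hb : b <> 0%R) :
  exists X : nat -> {ffun 'I_n -> ratfun (n - 3)},
    injective X /\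
    forall k : nat,
      parametric_solution i a b (X k) /\ depends_on_all_parameters (X k).
Proof.
move/eqP in hb.
case: n hn hin => [|[|[|[|m]]]] // _ lt_im.
case: i hi2 lt_im => [|[|r]] // _ lt_rm.
change (m.+4 - 3)%N with m.+1.
(* As n = m + 4 and i = r + 2, the alternative is i <= n - 2 or i = n - 1. *)
have [le_rm|lt_mr] := leqP r m; first exact: middle_case.
have {lt_rm lt_mr} -> : r = m.+1 by lia.
have [ma|] := boolP ((0 < m)%N || (a != 0)); first exact: penultimate_case.
rewrite negb_or -leqNgt leqn0 negbK => /andP[/eqP-> /eqP->].
exact: euler_case.
Qed.
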